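(* Let $I\subseteq\overline{\mathbb R}[x_1,\dots,x_n]$ be a tropical ideal. For any $a\in\overline{\mathbb R}$, the ideal $I|_{x_n=a}:=\{f(x_1,\dots,x_{n-1},a):f\in I\}\subseteq\overline{\mathbb R}[x_1,\dots,x_{n-1}]$ is also a tropical ideal.
   Context: $\overline{\mathbb R}=(\mathbb R\cup\{\infty\},\oplus,\odot)$ with $a\oplus b=\min(a,b)$, $a\odot b=a+b$ (so $\infty$ is the additive identity and $0$ the multiplicative identity; substituting $a=\infty$ kills all terms involving $x_n$). For a polynomial $f$, $[f]_{\mathbf x^{\mathbf u}}$ denotes the coefficient of the monomial $\mathbf x^{\mathbf u}$. An ideal $I$ is a tropical ideal if for all $f,g\in I$ and every monomial $\mathbf x^{\mathbf u}$ with $[f]_{\mathbf x^{\mathbf u}}=[g]_{\mathbf x^{\mathbf u}}\neq\infty$ there exists $h\in I$ with $[h]_{\mathbf x^{\mathbf u}}=\infty$ and $[h]_{\mathbf x^{\mathbf v}}\ge\min([f]_{\mathbf x^{\mathbf v}},[g]_{\mathbf x^{\mathbf v}})$ for all monomials $\mathbf x^{\mathbf v}$, with equality whenever $[f]_{\mathbf x^{\mathbf v}}\ne[g]_{\mathbf x^{\mathbf v}}$. *)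

(* Defs.v *)
From Stdlib Require Import Reals.
From mathcomp Require Import all_boot.

Set Implicit Arguments.
Unset Strict Implicit.
Unset Printing Implicit Defensive.

Inductive trop : Type := Fin (r : R) | Inf.

Definition tadd (a b : trop) : trop :=
  match a, b with
  | Fin x, Fin y => Fin (Rmin x y)
  | Inf, _ => b
  | _, Inf => a
  end.

Definition tmul (a b : trop) : trop :=
  match a, b with
  | Fin x, Fin y => Fin (Rplus x y)
  | _, _ => Inf
  end.

(* tropical power a^k; a^0 = 0 (the multiplicative identity), also for a = Inf *)
Fixpoint tpow (a : trop) (k : nat) : trop :=
  match k with
  | O => Fin R0
  | S k' => tmul a (tpow a k')
  end.

Definition tle (a b : trop) : Prop :=
  match a, b with
  | _, Inf => True
  | Inf, Fin _ => False
  | Fin x, Fin y => Rle x y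
  end.

(* x is the minimum (in Rbar) of the set S of values; the minimum of an empty
   set (or a set containing only Inf) is Inf.  All sets to which this is
   applied below are finite up to Inf-values, so the minimum exists. *)
Definition is_tmin (S : trop -> Prop) (x : trop) : Prop :=
  (forall y, S y -> tle x y) /\ (x = Inf \/ S x).

Definition mon (n : nat) := {ffun 'I_n -> nat}.

Definition tseries (n : nat) := mon n -> trop.

(* polynomials = finitely supported coefficient functions *)
Definition is_tpoly (n : nat) (f : tseries n) : Prop :=
  exists N : nat, forall u : mon n, f u <> Inf -> forall i, u i < N.

Definition tpadd (n : nat) (f g : tseries n) : tseries n :=
  fun u => tadd (f u) (g u).

Definition is_tpmul (n : nat) (f g h : tseries n) : Prop :=
  forall u : mon n,
    is_tmin (fun y => exists v w : mon n,
                 (forall i, u i = v i + w i) /\ y = tmul (f v) (g w)) (h u).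

Definition is_tideal (n : nat) (I : tseries n -> Prop) : Prop :=
  [/\ (forall f, I f -> is_tpoly f),
      (exists f, I f),
      (forall f g, I f -> I g -> I (tpadd f g)) &
      (forall f g h, I f -> is_tpoly g -> is_tpmul f g h -> I h)].

Definition is_tropical_ideal (n : nat) (I : tseries n -> Prop) : Prop :=
  is_tideal I /\
  forall (f g : tseries n) (u : mon n),
    I f -> I g -> f u = g u -> f u <> Inf ->
    exists h, [/\ I h, h u = Inf &
      forall v : mon n, tle (tadd (f v) (g v)) (h v) /\
                        (f v <> g v -> h v = tadd (f v) (g v))].

Definition mon_ext (n : nat) (u' : mon n) (k : nat) : mon n.+1 :=
  [ffun i : 'I_n.+1 => if unlift ord_max i is Some j then u' j else k].

Definition is_tsubst_last (n : nat) (f : tseries n.+1) (a : trop) (g : tseries n)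
  : Prop :=
  forall u' : mon n,
    is_tmin (fun y => exists k : nat, y = tmul (f (mon_ext u' k)) (tpow a k)) (g u').

Definition tsubst_ideal (n : nat) (I : tseries n.+1 -> Prop) (a : trop)
  : tseries n -> Prop :=
  fun g => exists f, I f /\ is_tsubst_last f a g.

(* Main.v *)
(* For a = Inf, substitution reads off the coefficients at exponent 0 and
   elimination is inherited.  For finite a, rescaling reduces to minima
   F(v) = min_k f(v,k), G(v) = min_k g(v,k), and one must kill the whole row
   u, where F(u) = G(u).  Since sums stay in the ideal, it suffices to keep the
   minimum at one v with, say, F(v) < G(v).  Classically one would take
   P f - Q g with P, Q polynomials in x_n of Gauss norm one; tropically, Gaussian
   elimination on sufficiently many products x_n^i f, x_n^j g does this:  pivots
   of smallest valuation keep all lower bounds, and a unitriangular pattern of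
   attained minima survives, as in Gauss's lemma. *)

Require Import Defs.
From Stdlib Require Import Reals Lra Classical ClassicalEpsilon.
From mathcomp Require Import all_boot zify.

Set Implicit Arguments.
Unset Strict Implicit.
Unset Printing Implicit Defensive.

(** * Arithmetic and order of the tropical numbers, and existence of minima *)

Ltac trop_cases :=
  intros; repeat match goal with x : trop |- _ => destruct x end; simpl in *;
  unfold Rmin in *;
  repeat match goal with |- context [Rle_dec ?x ?y] => case: (Rle_dec x y) => ? end;
  simpl in *;
  try solve [ done | lra | tauto | congruence | f_equal; lra ].

Lemma tle_refl a : tle a a. Proof. by trop_cases. Qed.

Lemma tle_trans a b c : tle a b -> tle b c -> tle a c.
Proof. by trop_cases. Qed.

Lemma tle_anti a b : tle a b -> tle b a -> a = b.
Proof. by trop_cases. Qed.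

Lemma tle_total a b : tle a b \/ tle b a.
Proof. by case: a b => [x|] [y|] /=; auto; lra. Qed.

Lemma tle_inf a : tle a Inf. Proof. by case: a. Qed.

Lemma inf_tle a : tle Inf a -> a = Inf. Proof. by case: a. Qed.

Lemma tadd_lel a b : tle (tadd a b) a. Proof. by trop_cases. Qed.

Lemma tadd_ler a b : tle (tadd a b) b. Proof. by trop_cases. Qed.

Lemma tle_tadd a b c : tle c a -> tle c b -> tle c (tadd a b).
Proof. by trop_cases. Qed.

Lemma taddC a b : tadd a b = tadd b a. Proof. by trop_cases. Qed.

Lemma tadd_idl a b : tle a b -> tadd a b = a. Proof. by trop_cases. Qed.

Lemma tadd_or a b : tadd a b = a \/ tadd a b = b.
Proof.
by have [le|le] := tle_total a b; [left | right; rewrite taddC]; apply: tadd_idl.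
Qed.

Lemma tmulC a b : tmul a b = tmul b a. Proof. by trop_cases. Qed.

Lemma tmulA a b c : tmul a (tmul b c) = tmul (tmul a b) c.
Proof. by trop_cases. Qed.

Lemma tmul_inf a : tmul a Inf = Inf.
Proof. by trop_cases. Qed.

Lemma tmul_le a b c d : tle a b -> tle c d -> tle (tmul a c) (tmul b d).
Proof. by trop_cases. Qed.

Lemma tmul_addl a b c : tmul (tadd a b) c = tadd (tmul a c) (tmul b c).
Proof. by trop_cases. Qed.

Lemma tmul_finI (r : R) a b : tmul a (Fin r) = tmul b (Fin r) -> a = b.
Proof. by case: a b => [x|] [y|] //= [H]; f_equal; lra. Qed.

Lemma tpow_fin (r : R) k : exists s, tpow (Fin r) k = Fin s.
Proof. by elim: k => [|k [s IH]] /=; [exists R0 | rewrite IH; eexists]. Qed.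

Lemma tpowD a i j : tpow a (i + j) = tmul (tpow a i) (tpow a j).
Proof.
elim: i => [|i IH]; last by rewrite addSn /= IH tmulA.
by rewrite add0n /=; case: (tpow a j) => //= r; f_equal; lra.
Qed.

Lemma is_tmin_unique S x y : is_tmin S x -> is_tmin S y -> x = y.
Proof.
move=> [lx ax] [ly ay]; apply: tle_anti.
  by case: ay => [->|/lx //]; apply: tle_inf.
by case: ax => [->|/ly //]; apply: tle_inf.
Qed.

(** Only the finite values of [S] have to come from the list [s]. The induction splits the value
    [F a] off [S] and compares it with the minimum of the rest. *)
Lemma is_tmin_exists (A : eqType) (s : seq A) (F : A -> trop) (S : trop -> Prop) :
  (forall y, S y -> y <> Inf -> exists2 x, x \in s & y = F x) ->
  exists x, is_tmin S x.
Proof.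
elim: s S => [|a s IH] S cover.
  exists Inf; split; last by left.
  by move=> y /cover; case: y => // r; case.
have [|x [lx ax]] := IH (fun y => S y /\ y <> F a).
  move=> y [Sy yNa] /(cover _ Sy) [z]; rewrite inE => /orP [/eqP -> //|zs yF].
  by exists z.
have [Sa|NSa] := classic (S (F a)); last first.
  exists x; split; last by case: ax => [|[]]; auto.
  by move=> y Sy; apply: lx; split=> // yF; rewrite yF in Sy.
exists (tadd (F a) x); split.
  move=> y Sy; have [->|yNa] := classic (y = F a); first exact: tadd_lel.
  by apply: tle_trans (tadd_ler _ _) _; apply: lx.
right; have [le|le] := tle_total (F a) x; first by rewrite tadd_idl.
rewrite taddC tadd_idl //; case: ax => [xI|[] //].
by rewrite xI in le *; rewrite -(inf_tle le).
Qed.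

Lemma ex_least (P : nat -> Prop) :
  (exists k, P k) -> exists k, P k /\ forall j, j < k -> ~ P j.
Proof.
move=> [k]; elim/ltn_ind: k => k IH Pk.
have [[j [jk Pj]]|none] := classic (exists j, j < k /\ P j); first exact: IH Pj.
by exists k; split=> // j jk Pj; apply: none; exists j.
Qed.

(** * Gaussian elimination for tropical vectors over an arbitrary index set *)

(** The elimination axiom for vectors of a valuated matroid, freed from monomials so that it also
    applies to coefficients indexed by pairs (monomial, exponent of [x_n]). *)
Definition vector_elimination (X : Type) (V : (X -> trop) -> Prop) : Prop :=
  forall f g e, V f -> V g -> f e = g e -> f e <> Inf ->
  exists h, [/\ V h, h e = Inf &
    forall x, tle (tadd (f x) (g x)) (h x) /\
              (f x <> g x -> h x = tadd (f x) (g x))].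

Definition scale_closed (X : Type) (V : (X -> trop) -> Prop) : Prop :=
  forall (c : R) f, V f -> V (fun x => tmul (Fin c) (f x)).

(** The eliminated vector lies above the minimum of [f] and [g], so it is [Inf] wherever both are.
    Hence entries once killed stay killed in later eliminations. *)
Lemma vanish_closed (X : Type) (V : (X -> trop) -> Prop) (P : X -> Prop) :
  scale_closed V -> vector_elimination V ->
  let W f := V f /\ forall x, P x -> f x = Inf in
  scale_closed W /\ vector_elimination W.
Proof.
move=> sc el W; split.
  by move=> c f [Vf f0]; split; [exact: sc | move=> x /f0 ->].
move=> f g e [Vf f0] [Vg g0] fg fN; have [h [Vh h0 hx]] := el _ _ _ Vf Vg fg fN.
exists h; split=> //; split=> // x Px.
by apply: inf_tle; have [] := hx x; rewrite f0 // g0.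
Qed.

(** Chooses the pivot row in [eliminate]. Taking the largest index on a tie, any other row tied with
    the pivot precedes it, which is where triangularity controls the pivot. *)
Lemma exists_pivot (F : nat -> trop) (S : seq nat) : 0 < size S ->
  exists2 p, p \in S &
    forall i, i \in S -> tle (F p) (F i) /\ (F i = F p -> i <= p).
Proof.
elim: S => // a [|b S] IH _.
  exists a; first exact: mem_head.
  by move=> i /predU1P [->|//]; split=> //; apply: tle_refl.
have [//|p pS pmin] := IH.
have [pa|pNa] := classic (tle (F p) (F a) /\ (F a = F p -> a <= p)).
  by exists p; [rewrite inE pS orbT | move=> i /predU1P [->|/pmin]].
have [ap app] : tle (F a) (F p) /\ (F p = F a -> p <= a).
  have [pa|ap] := tle_total (F p) (F a); last first.
    split=> // e; case: (leqP p a) => // /ltnW ?; case: pNa.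
    by rewrite e; split=> //; apply: tle_refl.
  have [e|ne] := classic (F a = F p); last by case: pNa.
  rewrite e; split; first exact: tle_refl.
  by move=> _; case: (leqP p a) => // /ltnW ?; case: pNa.
exists a; first by rewrite inE eqxx.
move=> i /predU1P [->|/pmin [pi pp]]; first by split=> //; apply: tle_refl.
split; first exact: tle_trans pi.
move=> e; have ipe : F i = F p by apply: tle_anti pi; rewrite e.
by apply: leq_trans (pp ipe) (app _); rewrite -ipe.
Qed.

(** Since [g e] is at most [f e], making the two entries equal only raises [g], so [b] remains a
    lower bound. If [g] is raised strictly, it can no longer attain a finite value of [b]; only a
    tie at [e] needs the assumption on [g x]. *)
Lemma eliminate_one (X : Type) (V : (X -> trop) -> Prop) (b f g : X -> trop) (e : X) :
  scale_closed V -> vector_elimination V -> V f -> V g ->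
  (forall x, tle (b x) (f x)) -> (forall x, tle (b x) (g x)) ->
  tle (g e) (f e) ->
  exists h, [/\ V h, h e = Inf, forall x, tle (b x) (h x) &
    forall x, b x <> Inf -> (f e = g e -> g x <> b x) ->
      (h x = b x <-> f x = b x)].
Proof.
move=> sc el Vf Vg bf bg gf.
case fe : (f e) => [r|]; last by exists f; split.
case ge : (g e) => [s|]; last by rewrite fe ge in gf.
have sr : Rle s r by rewrite fe ge in gf.
have [||h [Vh h0 hx]] := el f (fun x => tmul (Fin (Rminus r s)) (g x)) e Vf (sc _ _ Vg).
- by rewrite fe ge /=; f_equal; lra.
- by rewrite fe.
have bcg x : tle (b x) (tmul (Fin (Rminus r s)) (g x)).
  by move: (bg x); case: (b x) (g x) => [?|] [?|] //=; lra.
exists h; split=> // x; first by apply: tle_trans (proj1 (hx x)); apply: tle_tadd.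
move=> bN gN; have {}gN : tmul (Fin (Rminus r s)) (g x) <> b x.
  move: (bg x) gN; case: (b x) (g x) bN => [p|] [q|] //= _ pq gN [E].
  by apply: gN; f_equal; lra.
have [hl he] := hx x; split=> [hb|fb]; last first.
  by rewrite he fb; [apply: tadd_idl | move=> E; apply: gN].
apply: tle_anti (bf x); rewrite hb in hl.
have [E|E] := tadd_or (f x) (tmul (Fin (Rminus r s)) (g x)); rewrite E in hl => //.
by case: gN; apply: tle_anti (bcg x).
Qed.

(* The matrix (w_i (t_j)) is unitriangular modulo entries above [b]; pivoting on
   the smallest entry of a column, with ties broken by the largest index, keeps
   it so. *)
Lemma eliminate (X : eqType) (b : X -> trop) (E : seq X) (S : seq nat)
    (V : (X -> trop) -> Prop) (w : nat -> X -> trop) (t : nat -> X) :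
  scale_closed V -> vector_elimination V -> uniq S -> size E < size S ->
  (forall i, i \in S -> [/\ V (w i), forall x, tle (b x) (w i x),
     w i (t i) = b (t i) & b (t i) <> Inf]) ->
  (forall i j, i \in S -> j \in S -> i < j -> w j (t i) <> b (t i)) ->
  exists h i, [/\ V h, forall x, tle (b x) (h x), {in E, forall e, h e = Inf},
    i \in S & h (t i) = b (t i)].
Proof.
elim: E S V w => [|e E IH] S V w sc el Su ES wS wlt.
  case: S ES Su wS {wlt} => // i S _ _ wS; have [Vw bw wt _] := wS i (mem_head _ _).
  by exists (w i), i; split=> //; apply: mem_head.
have [|p pS pmin] := exists_pivot (w^~ e) (S := S); first exact: leq_trans ES.
have [Vp bp _ _] := wS p pS.
(* Membership sits inside the existential so that choice yields a family indexed by all of [nat]. *)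
have step i : exists h, i \in rem p S -> [/\ V h, h e = Inf,
    forall x, tle (b x) (h x), h (t i) = b (t i) &
    forall j, j \in S -> j < i -> h (t j) <> b (t j)].
  case: (boolP (i \in rem p S)) => [|_]; last by exists (w i).
  rewrite mem_rem_uniq // inE => /andP [ip iS]; have [Vi bi wti _] := wS i iS.
  have [pi ppi] := pmin i iS.
  have [h [Vh h0 bh hb]] := eliminate_one sc el Vi Vp bi bp pi.
  (* On a tie with the pivot, [i < p], hence [j < p], and triangularity says that [w p] does not
     attain [b] at [t j]. *)
  have {}hb j : j \in S -> j <= i -> h (t j) = b (t j) <-> w i (t j) = b (t j).
    move=> jS ji; have [_ _ _ btj] := wS j jS; apply: hb btj _ => /ppi ilep.
    by apply: wlt => //; apply: leq_ltn_trans ji _; rewrite ltn_neqAle ip.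
  exists h => _; split=> //; first exact/hb.
  by move=> j jS ji /(hb _ jS (ltnW ji)); apply: wlt.
pose w' i := proj1_sig (constructive_indefinite_description _ (step i)).
have w'P i := proj2_sig (constructive_indefinite_description _ (step i)).
(* The induction continues among the vectors that vanish at [e]. *)
have [sc' el'] := vanish_closed (eq e) sc el.
have [||||h [i [[Vh h0] bh hE iS hi]]] := IH (rem p S) _ w' sc' el'.
- exact: rem_uniq.
- by rewrite size_rem // -ltnS prednK //; apply: leq_trans ES.
- move=> i iS; have [Vw we bw wt _] := w'P i iS.
  have [_ _ _ bN] := wS i (mem_rem iS).
  by split=> //; split=> // x <-.
- move=> i j iS jS ij; have [_ _ _ _] := w'P j jS; apply=> //.
  exact: mem_rem iS.
exists h, i; split=> //; last exact: mem_rem iS.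
by move=> x /predU1P [->|/hE //]; apply: h0.
Qed.

(** * Killing a whole row by eliminating among shifts *)

(** Multiplication by [x_n^m], the second component being the exponent of [x_n]. *)
Definition shift (T : Type) (m : nat) (f : T * nat -> trop) : T * nat -> trop :=
  fun z => if z.2 < m then Inf else f (z.1, z.2 - m).

(* With N shifts of [f] and N shifts of [g], there is one vector more than the
   2N - 1 entries to be killed in the row of [u].  The shifts of [g] can only
   keep an attained minimum in that row, so the surviving one lies in the row of
   [v]. *)
Lemma eliminate_row (T : eqType) (V : (T * nat -> trop) -> Prop)
    (f g : T * nat -> trop) (F G : T -> trop) (N : nat) (u v : T) :
  scale_closed V -> vector_elimination V ->
  (forall m h, V h -> V (shift m h)) -> V f -> V g ->
  (forall t k, N <= k -> f (t, k) = Inf) -> (forall t k, N <= k -> g (t, k) = Inf) ->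
  (forall t k, tle (F t) (f (t, k))) -> (forall t k, tle (G t) (g (t, k))) ->
  F u = G u -> G u <> Inf -> (exists l, g (u, l) = G u) ->
  tle (F v) (G v) -> F v <> G v -> (exists k, f (v, k) = F v) ->
  exists h, [/\ V h, forall t k, tle (tadd (F t) (G t)) (h (t, k)),
    forall k, h (u, k) = Inf & exists k, h (v, k) = F v].
Proof.
move=> sc el sh Vf Vg fN gN Ff Gg FGu Gu /ex_least [l [gl lmin]] FGv FGvN.
move=> /ex_least [k [fk kmin]].
have Fv : F v <> Inf by move=> E; rewrite E in FGv FGvN; rewrite (inf_tle FGv) in FGvN.
pose b (z : T * nat) := tadd (F z.1) (G z.1).
have bu j : b (u, j) = G u by rewrite /b /= FGu tadd_idl //; apply: tle_refl.
have bv j : b (v, j) = F v by rewrite /b /= tadd_idl.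
(* A shift of [f] is tested where its first minimum in row [v] lands, a shift of [g] where its first
   minimum in row [u] lands. Shifts below [N] of supports below [N] reach at most exponent [2N - 2],
   which gives the [2N - 1] entries of [E]. *)
pose w i := if i < N then shift i f else shift (i - N) g.
pose t i := if i < N then (v, k + i) else (u, l + (i - N)).
pose E := [seq (u, j) | j <- iota 0 (N + N).-1].
have N0 : 0 < N by case: (posnP N) => // E0; case: Fv; rewrite -fk fN // E0.
(* Keeping the tail of row [u] at [Inf] makes killing [E] kill the entire row. *)
have [sc' el'] := vanish_closed (fun z => z.1 = u /\ (N + N).-1 <= z.2) sc el.
have bsh i z : tle (b z) (shift i f z) /\ tle (b z) (shift i g z).
  rewrite /shift; case: (z.2 < i); first by split; apply: tle_inf.
  by split; [apply: tle_trans (tadd_lel _ _) (Ff _ _)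
            |apply: tle_trans (tadd_ler _ _) (Gg _ _)].
have [||||h [i [[Vh h0] bh hE iS hi]]] :=
  @eliminate _ b E (iota 0 (N + N)) _ w t sc' el'.
- exact: iota_uniq.
- by rewrite size_map !size_iota; lia.
- move=> i; rewrite mem_iota => /andP [_ iN]; rewrite /w /t.
  have far m q s : m < N -> (forall k, N <= k -> q (u, k) = Inf) ->
      s.1 = u /\ (N + N).-1 <= s.2 -> shift m q s = Inf.
    case: s => s1 s2 mN qN /= [-> s2N]; rewrite /shift /=.
    by case: ltnP => // ms; apply: qN; lia.
  case: ltnP => iN'; split.
  + by split; [exact: sh | move=> x; apply: far => // j; apply: fN].
  + by move=> x; case: (bsh i x).
  + by rewrite bv /shift /= ifN ?addnK // -leqNgt leq_addl.
  + by rewrite bv.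
  + by split; [exact: sh | move=> x; apply: far => [|j]; [lia | apply: gN]].
  + by move=> x; case: (bsh (i - N) x).
  + by rewrite bu /shift /= ifN ?addnK // -leqNgt leq_addl.
  + by rewrite bu.
(* Unitriangularity: for two shifts of the same vector it is the minimality of [k] or [l]; a later
   shift of [g] cannot attain [F v], which is strictly below [G v]. *)
- move=> i j _ _ ij; rewrite /w /t /shift.
  case: (ltnP i N) => iN; case: (ltnP j N) => jN /=; rewrite ?bv ?bu.
  + by case: ltnP => [_ /esym //|kj]; apply: kmin; lia.
  + case: ifP => [_ /esym //|_] E0; case: FGvN; apply: tle_anti => //.
    by rewrite -E0; apply: Gg.
  + by lia.
  + by case: ltnP => [_ /esym //|kj]; apply: lmin; lia.
have hu j : h (u, j) = Inf.
  case: (ltnP j (N + N).-1) => jN; last exact: h0.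
  by apply: hE; apply: map_f; rewrite mem_iota.
exists h; split=> //; first by move=> x j; apply: (bh (x, j)).
move: hi; rewrite /t; case: ifP => _; first by rewrite bv; eexists; eassumption.
by rewrite hu bu => /esym.
Qed.

(** Each row [v] of [L] gets its own vector killing row [u], with [f] and [g] exchanged if [G v] is
    the smaller. The tropical sum of these vectors keeps the lower bound and every attained
    minimum. *)
Lemma eliminate_row_all (T : eqType) (V : (T * nat -> trop) -> Prop)
    (f g : T * nat -> trop) (F G : T -> trop) (N : nat) (u : T) (L : seq T) :
  scale_closed V -> vector_elimination V ->
  (forall m h, V h -> V (shift m h)) -> V (fun _ => Inf) ->
  (forall h h', V h -> V h' -> V (fun x => tadd (h x) (h' x))) -> V f -> V g ->
  (forall t k, N <= k -> f (t, k) = Inf) -> (forall t k, N <= k -> g (t, k) = Inf) ->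
  (forall t k, tle (F t) (f (t, k))) -> (forall t k, tle (G t) (g (t, k))) ->
  (forall t, F t <> Inf -> exists k, f (t, k) = F t) ->
  (forall t, G t <> Inf -> exists k, g (t, k) = G t) ->
  F u = G u -> F u <> Inf ->
  exists h, [/\ V h, forall t k, tle (tadd (F t) (G t)) (h (t, k)),
    forall k, h (u, k) = Inf &
    {in L, forall v, F v <> G v -> exists k, h (v, k) = tadd (F v) (G v)}].
Proof.
move=> sc el sh V0 Vadd Vf Vg fN gN Ff Gg fF gG FGu Fu.
elim: L => [|v L [h [Vh bh hu hL]]].
  by exists (fun _ => Inf); split=> // t k; apply: tle_inf.
have attained x y : tle x y -> x <> y -> x <> Inf by case: x y => [?|] [?|].
suff [h' [Vh' bh' hu' hv]] : exists h', [/\ V h',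
    forall t k, tle (tadd (F t) (G t)) (h' (t, k)), forall k, h' (u, k) = Inf &
    F v <> G v -> exists k, h' (v, k) = tadd (F v) (G v)].
  exists (fun x => tadd (h' x) (h x)); split=> [|t k|k|t].
  - exact: Vadd.
  - exact: tle_tadd.
  - by rewrite hu hu'.
  move=> /predU1P [->|/hL {}hL] FGt.
    by have [k hk] := hv FGt; exists k; rewrite hk tadd_idl.
  by have [k hk] := hL FGt; exists k; rewrite hk taddC tadd_idl.
have [FGv|FGv] := classic (F v = G v).
  by exists h; split.
have [le|le] := tle_total (F v) (G v).
  have [|||||h' [? ? ? hv]] := @eliminate_row T V f g F G N u v sc el sh Vf Vg fN gN Ff Gg FGu.
  - by rewrite -FGu.
  - by apply: gG; rewrite -FGu.
  - exact: le.
  - exact: FGv.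
  - by apply: fF; apply: attained le FGv.
  by exists h'; split=> // _; rewrite tadd_idl.
have GFv : G v <> F v by move=> E; apply: FGv.
have [||||h' [? bh' ? hv]] :=
  @eliminate_row T V g f G F N u v sc el sh Vg Vf gN fN Gg Ff (esym FGu) Fu.
- exact: fF.
- exact: le.
- exact: GFv.
- by apply: gG; apply: attained le GFv.
exists h'; split=> // [t k|_]; first by rewrite taddC.
by rewrite taddC tadd_idl.
Qed.

(** * Monomials and products of polynomials *)

Definition mon_box (n N : nat) : seq (mon n) :=
  codom (fun t : {ffun 'I_n -> 'I_N} => [ffun i => val (t i)] : mon n).

Lemma mem_mon_box n N (u : mon n) : (forall i, u i < N) -> u \in mon_box n N.
Proof.
move=> uN; suff -> : u = [ffun i => val ([ffun i => Ordinal (uN i)] i)].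
  exact: codom_f.
by apply/ffunP => i; rewrite !ffunE.
Qed.

Definition mon_add (n : nat) (u v : mon n) : mon n := [ffun i => u i + v i].

(** Only [v] in the finite support of [f] contributes, and [v] determines the cofactor [u - v]. *)
Lemma tpmul_exists n (f g : tseries n) : is_tpoly f -> exists h, is_tpmul f g h.
Proof.
move=> [N fN].
suff ex (u : mon n) : exists y, is_tmin (fun y => exists v w : mon n,
    (forall i, u i = v i + w i) /\ y = tmul (f v) (g w)) y.
  exists (fun u => proj1_sig (constructive_indefinite_description _ (ex u))) => u.
  exact: proj2_sig (constructive_indefinite_description _ (ex u)).
apply: (@is_tmin_exists _ (mon_box n N)
  (fun v => tmul (f v) (g [ffun i => u i - v i]))).
move=> _ [v [w [uvw ->]]] fgN; exists v.
  by apply: mem_mon_box; apply: fN => fv; rewrite fv in fgN.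
by congr (tmul _ (g _)); apply/ffunP => i; rewrite ffunE uvw addKn.
Qed.

(** Reads off the coefficients of [f] times the monomial [c x^m] from the relational product. The
    value [c = Inf] is allowed and gives the zero polynomial. *)
Lemma tideal_monomial n (I : tseries n -> Prop) (f : tseries n) (m : mon n) (c : trop) :
  is_tideal I -> I f ->
  exists h, [/\ I h, forall z, h (mon_add m z) = tmul c (f z) &
    forall (z : mon n) i, z i < m i -> h z = Inf].
Proof.
move=> [poly _ _ mul] If; pose g := (fun w => if w == m then c else Inf) : tseries n.
have [h hP] := tpmul_exists g (poly _ If).
exists h; split.
- apply: mul hP => //; exists (\max_i m i).+1 => w; rewrite /g.
  by case: eqP => // -> _ i; rewrite ltnS leq_bigmax.
- move=> z; have [hle hat] := hP (mon_add m z).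
  have le : tle (h (mon_add m z)) (tmul c (f z)).
    apply: hle; exists z, m; rewrite /g eqxx tmulC; split=> // i.
    by rewrite ffunE addnC.
  case: hat => [E|[v [w [mz E]]]]; first by rewrite E in le *; rewrite (inf_tle le).
  move: E le; rewrite /g; case: eqP => [wm|_]; last first.
    by rewrite tmul_inf => -> /inf_tle ->.
  suff -> : v = z by rewrite tmulC => -> _.
  apply/ffunP => i; have := mz i; rewrite wm ffunE addnC.
  by move/addIn.
- move=> z i zm; case: (hP z) => _ [//|[v [w [zvw ->]]]].
  rewrite /g; case: eqP => [wm|_]; last by case: (f v).
  by have := zvw i; rewrite wm; lia.
Qed.

Definition mon_restrict (n : nat) (z : mon n.+1) : mon n :=
  [ffun j => z (lift ord_max j)].

Lemma mon_ext_last n (u : mon n) k : mon_ext u k ord_max = k.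
Proof. by rewrite ffunE unlift_none. Qed.

Lemma mon_ext_lift n (u : mon n) k j : mon_ext u k (lift ord_max j) = u j.
Proof. by rewrite ffunE liftK. Qed.

Lemma mon_extK n (u : mon n) k : mon_restrict (mon_ext u k) = u.
Proof. by apply/ffunP => j; rewrite ffunE mon_ext_lift. Qed.

Lemma mon_ext_restrict n (z : mon n.+1) : mon_ext (mon_restrict z) (z ord_max) = z.
Proof. by apply/ffunP => i; rewrite ffunE; case: unliftP => [j|] ->; rewrite ?ffunE. Qed.

Lemma mon_ext_add n (u v : mon n) k l :
  mon_add (mon_ext u k) (mon_ext v l) = mon_ext (mon_add u v) (k + l).
Proof. by apply/ffunP => i; rewrite !ffunE; case: unliftP => [j|] _; rewrite ?ffunE. Qed.

Lemma mon_ext_bound n (f : tseries n.+1) : is_tpoly f ->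
  exists N, forall u k, f (mon_ext u k) <> Inf -> k < N /\ forall i, u i < N.
Proof.
move=> [N fN]; exists N => u k /fN lt; split; first by rewrite -(mon_ext_last u k).
by move=> i; rewrite -(mon_ext_lift u k i).
Qed.

(** * Substitution for the last variable yields an ideal *)

Section SubstLast.

Variables (n : nat) (I : tseries n.+1 -> Prop) (a : trop).
Hypothesis idI : is_tideal I.

Lemma tsubst_exists (f : tseries n.+1) :
  is_tpoly f -> exists g, is_tsubst_last f a g.
Proof.
move=> /mon_ext_bound [N fN].
suff ex (u : mon n) : exists y,
    is_tmin (fun y => exists k, y = tmul (f (mon_ext u k)) (tpow a k)) y.
  exists (fun u => proj1_sig (constructive_indefinite_description _ (ex u))) => u.
  exact: proj2_sig (constructive_indefinite_description _ (ex u)).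
apply: (@is_tmin_exists _ (iota 0 N) (fun k => tmul (f (mon_ext u k)) (tpow a k))).
move=> _ [k ->] kN; exists k => //; rewrite mem_iota.
by have [] // := fN u k; move=> E; rewrite E in kN.
Qed.

Lemma tsubst_poly (f : tseries n.+1) (g : tseries n) : is_tpoly f -> is_tsubst_last f a g -> is_tpoly g.
Proof.
move=> /mon_ext_bound [N fN] fg; exists N => u; have [_ [//|[k ->]] kN] := fg u.
by have [] // := fN u k; move=> E; rewrite E in kN.
Qed.

Lemma tsubst_add (f1 f2 : tseries n.+1) (g1 g2 : tseries n) :
  is_tsubst_last f1 a g1 -> is_tsubst_last f2 a g2 ->
  is_tsubst_last (tpadd f1 f2) a (tpadd g1 g2).
Proof.
move=> s1 s2 u; have [l1 a1] := s1 u; have [l2 a2] := s2 u.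
have low y : (exists k, y = tmul (tpadd f1 f2 (mon_ext u k)) (tpow a k)) ->
    tle (tpadd g1 g2 u) y.
  move=> [k ->]; rewrite /tpadd tmul_addl; apply: tle_tadd.
    by apply: tle_trans (tadd_lel _ _) _; apply: l1; exists k.
  by apply: tle_trans (tadd_ler _ _) _; apply: l2; exists k.
split=> //; have [E|E] := tadd_or (g1 u) (g2 u).
  case: a1 => [gI|[k gk]]; first by left; rewrite /tpadd E.
  right; exists k; apply: tle_anti; first by apply: low; exists k.
  by rewrite /tpadd E gk; apply: tmul_le (tle_refl _); apply: tadd_lel.
case: a2 => [gI|[k gk]]; first by left; rewrite /tpadd E.
right; exists k; apply: tle_anti; first by apply: low; exists k.
by rewrite /tpadd E gk; apply: tmul_le (tle_refl _); apply: tadd_ler.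
Qed.

(** [g'] is [g] regarded as a polynomial free of [x_n]. In every finite term of [f g'] the whole
    power of [x_n] therefore comes from [f], so substitution commutes with this product. *)
Lemma tsubst_mul (f g' : tseries n.+1) (F g h : tseries n) :
  is_tsubst_last f a F -> is_tpmul F g h ->
  (forall z, g' z = if z ord_max == 0 then g (mon_restrict z) else Inf) ->
  forall h', is_tpmul f g' h' -> is_tsubst_last h' a h.
Proof.
move=> sF Fgh g'E h' fgh u.
have low y : (exists k, y = tmul (h' (mon_ext u k)) (tpow a k)) -> tle (h u) y.
  move=> [k ->]; have [_ [->|[v [w [uvw ->]]]]] := fgh (mon_ext u k).
    exact: tle_inf.
  rewrite g'E; case: eqP => [w0|_]; last by case: (f v) => *; apply: tle_inf.
  have vk : v ord_max = k by have := uvw ord_max; rewrite w0 addn0 mon_ext_last.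
  rewrite -tmulA [tmul (g _) _]tmulC tmulA.
  apply: tle_trans (_ : tle (tmul (F (mon_restrict v)) (g (mon_restrict w))) _).
    apply: (proj1 (Fgh u)); exists (mon_restrict v), (mon_restrict w); split=> // i.
    by have := uvw (lift ord_max i); rewrite mon_ext_lift !ffunE.
  apply: tmul_le (tle_refl _); apply: (proj1 (sF _)).
  by exists k; rewrite -{2}vk mon_ext_restrict.
split=> //; have [_ [|[v [w [uvw E]]]]] := Fgh u; first by left.
have [_ [F0|[k Fk]]] := sF v; first by left; rewrite E F0.
right; exists k; apply: tle_anti; first by apply: low; exists k.
rewrite E Fk -tmulA [tmul (tpow _ _) _]tmulC tmulA.
apply: tmul_le (tle_refl _); apply: (proj1 (fgh _)).
exists (mon_ext v k), (mon_ext w 0); rewrite g'E mon_ext_last mon_extK; split=> // i.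
by rewrite !ffunE; case: unliftP => [j|] _; rewrite ?addn0.
Qed.

Lemma tsubst_tideal : is_tideal (tsubst_ideal I a).
Proof.
have [poly [f0 If0] add mul] := idI; split.
- by move=> g [f [/poly pf fg]]; apply: tsubst_poly fg.
- by have [g fg] := tsubst_exists (poly _ If0); exists g, f0.
- move=> g1 g2 [f1 [If1 s1]] [f2 [If2 s2]]; exists (tpadd f1 f2).
  by split; [exact: add | exact: tsubst_add].
move=> F g h [f [If sF]] [N gN] Fgh.
pose g' := (fun z => if z ord_max == 0 then g (mon_restrict z) else Inf) : tseries n.+1.
have [h' fgh] := tpmul_exists g' (poly _ If).
exists h'; split; last exact: (tsubst_mul sF Fgh _ fgh).
(* The successor leaves room for the exponent 0 of [x_n] even if [N] is 0. *)
apply: mul fgh => //; exists N.+1 => z; rewrite /g'; case: eqP => // z0 /gN zN i.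
case: (unliftP ord_max i) => [j|] ->; last by rewrite z0.
by have := zN j; rewrite ffunE => /ltnW.
Qed.

End SubstLast.

(* Rescaling x_n by r turns the substitution x_n = r into the minimum over each row. *)
Definition twist (n : nat) (I : tseries n.+1 -> Prop) (r : R) (p : mon n * nat -> trop) :=
  exists2 f, I f & forall u k, p (u, k) = tmul (f (mon_ext u k)) (tpow (Fin r) k).

(** * Closure properties of the rescaled ideal *)

Section Twist.

Variables (n : nat) (I : tseries n.+1 -> Prop) (r : R).
Hypothesis tropI : is_tropical_ideal I.

(** Scaling is multiplication by the constant polynomial [c]; with [c = Inf] it supplies the zero
    vector. *)
Lemma twist_scale (c : trop) p : twist I r p -> twist I r (fun x => tmul c (p x)).
Proof.
move=> [f If fp]; pose o : mon n := [ffun=> 0].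
have [h [Ih hE _]] := tideal_monomial (mon_ext o 0) c (proj1 tropI) If.
exists h => // u k; rewrite fp tmulA -hE mon_ext_add; congr (tmul (h (mon_ext _ _)) _).
by apply/ffunP => i; rewrite !ffunE.
Qed.

Lemma twist_shift m p : twist I r p -> twist I r (shift m p).
Proof.
move=> [f If fp]; pose o : mon n := [ffun=> 0]; have [s rs] := tpow_fin r m.
(* Rescaling turns [x_n^m] into an additional constant [s], the tropical [m]-th power of [r]; the
   coefficient [-s] cancels it. *)
have [h [Ih hE h0]] :=
  tideal_monomial (mon_ext o m) (Fin (Ropp s)) (proj1 tropI) If.
exists h => // u k; rewrite /shift /=; case: ltnP => km.
  by rewrite (h0 _ ord_max) // !mon_ext_last.
have [j ->] : exists j, k = m + j by exists (k - m); rewrite subnKC.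
rewrite addKn fp tpowD rs.
have -> : mon_ext u (m + j) = mon_add (mon_ext o m) (mon_ext u j).
  by rewrite mon_ext_add; congr mon_ext; apply/ffunP => i; rewrite !ffunE.
rewrite hE; case: (f _) => // x; case: (tpow _ _) => //= y; f_equal; lra.
Qed.

Lemma twist_add p q :
  twist I r p -> twist I r q -> twist I r (fun x => tadd (p x) (q x)).
Proof.
move=> [f If fp] [g Ig gq]; have [[_ _ add _] _] := tropI.
by exists (tpadd f g) => [|u k]; [exact: add | rewrite fp gq -tmul_addl].
Qed.

(** The factor [tpow (Fin r) k] is finite, so equal rescaled entries come from equal coefficients,
    and elimination in [I] can be rescaled afterwards. *)
Lemma twist_elimination : vector_elimination (twist I r).
Proof.
move=> p q [u k] [f If fp] [g Ig gq]; have [s rs] := tpow_fin r k.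
rewrite fp gq rs => /tmul_finI fg pN.
have [|h [Ih h0 hx]] := proj2 tropI f g (mon_ext u k) If Ig fg.
  by move=> E; rewrite E in pN.
exists (fun x => tmul (h (mon_ext x.1 x.2)) (tpow (Fin r) x.2)); split.
- by exists h.
- by rewrite h0.
move=> [v l]; rewrite fp gq -tmul_addl /=; have [le eq] := hx (mon_ext v l); split.
  exact: tmul_le (tle_refl _).
by move=> ne; rewrite eq // => E; rewrite E in ne.
Qed.

End Twist.

(** * Elimination after substituting a finite value *)

Lemma tsubst_elimination n (I : tseries n.+1 -> Prop) (r : R) :
  is_tropical_ideal I -> vector_elimination (tsubst_ideal I (Fin r)).
Proof.
move=> tropI F G u [f [If sF]] [g [Ig sG]] FGu Fu.
have [idI _] := tropI; have [poly _ _ _] := idI.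
have [M fM] := mon_ext_bound (poly _ If); have [N gN] := mon_ext_bound (poly _ Ig).
pose tw (q : tseries n.+1) (z : mon n * nat) :=
  tmul (q (mon_ext z.1 z.2)) (tpow (Fin r) z.2).
have far q K : (forall u k, q (mon_ext u k) <> Inf -> k < K /\ forall i, u i < K) ->
    K <= M + N -> forall t k, M + N <= k -> tw q (t, k) = Inf.
  move=> qK KMN t k ke; rewrite /tw /=; suff -> : q (mon_ext t k) = Inf by [].
  by apply: NNPP => /qK [kK _]; move: (leq_ltn_trans KMN (leq_ltn_trans ke kK)); rewrite ltnn.
have low q Q : is_tsubst_last q (Fin r) Q -> forall t k, tle (Q t) (tw q (t, k)).
  by move=> sQ t k; apply: (proj1 (sQ t)); exists k.
have att q Q : is_tsubst_last q (Fin r) Q ->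
    forall t, Q t <> Inf -> exists k, tw q (t, k) = Q t.
  by move=> sQ t Qt; have [_ [//|[k ->]]] := sQ t; exists k.
have Vtw q : I q -> twist I r (tw q) by exists q.
(* Finitely many rows suffice: outside the box of side [M + N] both [F] and [G] are [Inf], so they
   can differ only inside it. *)
have [p [[h Ih hp] bp pu pL]] := eliminate_row_all (mon_box n (M + N))
  (fun c q => @twist_scale n I r tropI (Fin c) q) (twist_elimination (r := r) tropI)
  (@twist_shift n I r tropI) (twist_scale tropI Inf (Vtw _ If))
  (@twist_add n I r tropI) (Vtw _ If) (Vtw _ Ig)
  (far _ _ fM (leq_addr _ _)) (far _ _ gN (leq_addl _ _))
  (low _ _ sF) (low _ _ sG) (att _ _ sF) (att _ _ sG) FGu Fu.
have [H sH] := tsubst_exists (Fin r) (poly _ Ih).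
have Hmin v : tle (tadd (F v) (G v)) (H v).
  by have [_ [->|[k ->]]] := sH v; [exact: tle_inf | rewrite -hp].
exists H; split.
- by exists h.
- by have [_ [//|[k ->]]] := sH u; rewrite -hp.
(* An entry of row [v] of [p] attaining the bound forces [H v] down to it. *)
move=> v; split=> // FGv; apply: tle_anti => //.
have [|k pk] := pL v _ FGv; last first.
  by rewrite -pk hp; apply: (proj1 (sH v)); exists k.
apply: mem_mon_box => i.
have bound q K Q : (forall u k, q (mon_ext u k) <> Inf -> k < K /\ forall i, u i < K) ->
    is_tsubst_last q (Fin r) Q -> Q v <> Inf -> v i < K.
  move=> qK sQ Qv; have [k qk] := att _ _ sQ v Qv.
  by have [] // := qK v k; move=> E; rewrite -qk /tw /= E in Qv.
have [Fv|Fv] := classic (F v = Inf).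
  apply: leq_trans (leq_addl M N); apply: bound gN sG _ => Gv.
  by rewrite Fv Gv in FGv.
exact: leq_trans (bound _ _ _ fM sF Fv) (leq_addr N M).
Qed.

(** * Substituting infinity, and the conclusion *)

(** The power [tpow Inf k] is the multiplicative identity for [k = 0] and [Inf] otherwise, so only
    terms free of [x_n] survive. *)
Lemma tsubst_infE n (f : tseries n.+1) (g : tseries n) :
  is_tsubst_last f Inf g <-> forall u, g u = f (mon_ext u 0).
Proof.
have min u : is_tmin (fun y => exists k, y = tmul (f (mon_ext u k)) (tpow Inf k))
    (f (mon_ext u 0)).
  have E : tmul (f (mon_ext u 0)) (Fin R0) = f (mon_ext u 0).
    by case: (f _) => //= x; f_equal; lra.
  split; last by right; exists 0; rewrite /= E.
  move=> _ [[|k] ->]; first by rewrite /= E; apply: tle_refl.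
  by rewrite /= tmul_inf; apply: tle_inf.
split=> [fg u|fg u]; last by rewrite fg.
exact: is_tmin_unique (fg u) (min u).
Qed.

Theorem theorem3p3 (n : nat) (I : tseries n.+1 -> Prop) (a : trop) :
  is_tropical_ideal I -> is_tropical_ideal (tsubst_ideal I a).
Proof.
move=> tropI; split; first exact: tsubst_tideal (proj1 tropI).
case: a => [r|]; first exact: tsubst_elimination.
move=> F G u [f [If /tsubst_infE fF]] [g [Ig /tsubst_infE gG]].
rewrite fF gG => fg fN; have [h [Ih h0 hx]] := proj2 tropI _ _ _ If Ig fg fN.
exists (fun v => h (mon_ext v 0)); split=> //; last by move=> v; rewrite fF gG.
by exists h; split=> //; apply/tsubst_infE.
Qed.
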